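(* Let $\alpha,\beta\in\mathbb{R}$ with $\alpha>1$ and $\beta>0$. For $n\in\mathbb{N}$ and $t\in[0,1)$ put $$V_{\alpha,\beta}(n,t)=\sum_{p\le n}p^{-\alpha}\cos(2\pi p^{\beta}t),$$ where the sum is over all prime numbers $p\le n$. Then: (1) As $n\to\infty$, $V_{\alpha,\beta}(n,t)$ converges absolutely and uniformly in $t\in[0,1)$ to a continuous function $V_{\alpha,\beta}(t)=\sum_{p}p^{-\alpha}\cos(2\pi p^{\beta}t)$. (2) For every integer $m\ge 1$: if in addition $\alpha-m\beta>1$, then the function $V_{\alpha,\beta}$ is $C^m$, i.e. $m$ times continuously differentiable, on $[0,1)$.
   Context: Sums indexed by $p$ run over the prime numbers. Absolute convergence means that $\sum_p \left|p^{-\alpha}\cos(2\pi p^{\beta}t)\right|<\infty$ for each $t$. Differentiability at the endpoint $t=0$ of $[0,1)$ is understood one-sidedly. *)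

(* Defs.v *)
(* MathComp-Analysis, over an arbitrary [R : realType]. *)
From HB Require Import structures.
From mathcomp Require Import all_boot all_order all_algebra.
From mathcomp Require Import all_classical all_reals all_analysis.
Set Implicit Arguments.
Unset Strict Implicit.
Unset Printing Implicit Defensive.
Import Order.TTheory GRing.Theory Num.Theory.
Import numFieldNormedType.Exports.
Local Open Scope classical_set_scope.
Local Open Scope ring_scope.

Definition Vterm (R : realType) (alpha beta : R) (p : nat) (t : R) : R :=
  p%:R `^ (- alpha) * cos (2 * pi * p%:R `^ beta * t).

Definition Vpartial (R : realType) (alpha beta : R) (n : nat) (t : R) : R :=
  \sum_(0 <= p < n.+1 | prime p) Vterm alpha beta p t.

(* Being a [lim], this is meaningful only where the series converges. *)
Definition Vlim (R : realType) (alpha beta : R) (t : R) : R :=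
  \big[+%R/0]_(0 <= p <oo | prime p) Vterm alpha beta p t.

(* [l] is the derivative at [x] of the restriction of [f] to [D]: the
   difference quotient is only taken at points of [D] other than [x], so at
   an endpoint of an interval this is the one-sided derivative. *)
Definition is_derive_within (R : realType) (D : set R) (f : R -> R)
    (x l : R) : Prop :=
  (f y - f x) / (y - x) @[y --> within D x^'] --> l.

(* [f] restricted to [D] is of class C^m.  Meant for a [D] without isolated
   points, where derivatives within [D] are unique; the values of the
   derivative [g] outside [D] are irrelevant. *)
Fixpoint class_C (R : realType) (m : nat) (D : set R) (f : R -> R) : Prop :=
  match m with
  | 0 => {within D, continuous f}
  | k.+1 => exists g : R -> R,
      (forall x, D x -> is_derive_within D f x (g x)) /\ class_C k D g
  end.

(* Main.v *)
(** Each derivative of a cosine term [c cos(w t + phi)] is again such a term,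
    [c w cos(w t + phi + pi/2)].  So the class of series [sum_p c_p cos(w_p t + phi)]
    is stable under termwise differentiation, which is legitimate as soon as
    [sum_p |c_p w_p|] converges: the difference quotients are dominated by
    [|c_p w_p|] because [cos] is 1-Lipschitz, and Tannery's theorem applies.
    Here [c_p w_p^k] is [(2 pi)^k p^(k beta - alpha)], dominated by a convergent
    series over all integers when [alpha - k beta > 1]. *)
Require Import Defs.
From HB Require Import structures.
From mathcomp Require Import all_boot all_order all_algebra.
From mathcomp Require Import all_classical all_reals all_analysis.
From mathcomp Require Import ring lra.
Import Order.TTheory GRing.Theory Num.Theory.
Import numFieldNormedType.Exports.
Local Open Scope classical_set_scope.
Local Open Scope ring_scope.

(** Telescoping does the work of the integral test: with [c = s - 1], the term of index [n >= 2] is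
    at most [c^-1] times the drop of the power of exponent [- c] from [n - 1] to [n]. Partial sums
    thus stay below [1 + c^-1]. *)
Lemma is_cvg_series_powRN (R : realType) (s : R) : 1 < s ->
  cvgn (series (fun n => n%:R `^ (- s))).
Proof.
move=> s1; set c := s - 1; have c0 : 0 < c by rewrite subr_gt0.
have telescope x : 0 < x ->
    (x + 1) `^ (- s) <= c^-1 * (x `^ (- c) - (x + 1) `^ (- c)).
  move=> x0; have y0 : 0 < x + 1 by rewrite addr_gt0.
  have -> : - s = - c - 1 by rewrite /c; ring.
  rewrite powRB; last by rewrite (gt_eqF y0) implybT.
  rewrite powRr1 ?(ltW y0)// ler_pdivlMl// mulrCA lerBrDr.
  (* with [y = x + 1]: [(x / y) `^ (- c) >= 1 - c * ln (x / y) >= 1 + c / y] *)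
  have -> : x `^ (- c) = (x + 1) `^ (- c) * (x / (x + 1)) `^ (- c).
    rewrite -powRM ?divr_ge0 ?ltW//; congr powR; field; exact: lt0r_neq0.
  rewrite -[X in _ + X]mulr1 -mulrDr ler_pM2l ?powR_gt0//.
  have xy0 : 0 < x / (x + 1) by rewrite divr_gt0.
  rewrite /powR gt_eqF// addrC; apply: le_trans (expR_ge1Dx _).
  rewrite lerD2l mulNr -mulrN ler_pM2l// lerNr.
  have -> : x / (x + 1) = 1 + - (x + 1)^-1 by field; exact: lt0r_neq0.
  by apply: le_ln1Dx; rewrite ltrN2 invf_lt1// ltrDr.
have ge0 n : 0 <= n%:R `^ (- s) by exact: powR_ge0.
apply: nondecreasing_is_cvgn.
  by apply/nondecreasing_series => n _ _.
(* [telescope] needs [0 < x], so it first bounds the term of index 2. The term of index 0 vanishes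
   by [powR0], and that of index 1 is the leading 1. *)
have bnd n : series (fun n => n%:R `^ (- s)) n.+2 <=
    1 + c^-1 * (1 - n.+1%:R `^ (- c)).
  elim: n => [|n IH].
    rewrite /series/= !big_nat_recr//= big_geq// powR0 ?oppr_eq0; last by lra.
    by rewrite !powR1 !add0r subrr mulr0 addr0.
  rewrite seriesSr; apply: (le_trans (lerD IH (_ : _ <= _))).
    by rewrite -[n.+2]addn1 natrD; apply: telescope.
  rewrite -[n.+2]addn1 natrD; lra.
exists (1 + c^-1) => _ [n _ <-].
apply: le_trans (_ : _ <= series (fun n => n%:R `^ (- s)) n.+2) _.
  by rewrite !seriesSr -addrA lerDl addr_ge0.
by apply: le_trans (bnd n) _; rewrite lerD2l ler_piMr ?invr_ge0 ?(ltW c0)//.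
Qed.

(** On a finite block from [N] to [n] this is the triangle inequality; then [n] tends to infinity.
    The bound depends on [M] alone, hence is uniform over all series dominated by [M]. *)
Lemma series_tail_le (R : realType) (f M : R ^nat) (N : nat) :
  (forall n, `|f n| <= M n) -> cvgn (series M) ->
  `|limn (series f) - series f N| <= limn (series M) - series M N.
Proof.
move=> fM cM.
have cf : cvgn (series f).
  apply: normed_cvg; apply: series_le_cvg cM => // n; first exact: normr_ge0.
  exact: le_trans (normr_ge0 _) (fM n).
have cfN : series f n - series f N @[n --> \oo] --> limn (series f) - series f N.
  by apply: cvgB => //; exact: cvg_cst.
rewrite -(cvg_lim _ (cvg_norm cfN))//; apply: limr_le.
  by apply/cvg_ex; eexists; exact: cvg_norm cfN.
near=> n; have Nn : (N <= n)%N by near: n; exact: nbhs_infty_ge.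
have ndM : nondecreasing_seq (series M).
  apply/nondecreasing_series => k _ _; exact: le_trans (normr_ge0 _) (fM k).
apply: (@le_trans _ _ (series M n - series M N)); last first.
  by rewrite lerD2r; exact: nondecreasing_cvgn_le.
rewrite !sub_series_geq//; apply: le_trans (ler_norm_sum _ _ _) _.
by apply: ler_sum.
Unshelve. all: by end_near. Qed.

(** Past a suitable [N] both tails are at most [e / 4], and the finite sums converge termwise. A
    general filter covers [nbhs x] (continuity) and [within D x^'] (derivatives). Since it may be
    improper, the bound on [l] is assumed rather than deduced from that on [f]. *)
Lemma tannery (R : realType) (T : Type) (F : set_system T) (FF : Filter F)
    (f : T -> R ^nat) (l M : R ^nat) :
  cvgn (series M) -> (\forall t \near F, forall n, `|f t n| <= M n) ->
  (forall n, `|l n| <= M n) -> (forall n, f t n @[t --> F] --> l n) ->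
  limn (series (f t)) @[t --> F] --> limn (series l).
Proof.
move=> cM fM lM fl; apply/cvgrPdist_le => e e0.
have [N tailN] : exists N, limn (series M) - series M N <= e / 4.
  have /cvgrPdist_le/(_ (e / 4)) := cM.
  rewrite divr_gt0// => /(_ isT)[N _ /(_ N (leqnn N))] /=.
  by move=> /(le_trans (ler_norm _)); exists N.
have cN : series (f t) N @[t --> F] --> series l N.
  elim: N {tailN} => [|N IH].
    rewrite seriesEord/= big_ord0; under eq_fun do rewrite seriesEord/= big_ord0.
    exact: cvg_cst.
  rewrite seriesSr; under eq_fun do rewrite seriesSr.
  exact: cvgD.
have /cvgrPdist_le/(_ (e / 2)) := cN; rewrite divr_gt0// => /(_ isT) dN.
near=> t.
have ft : forall n, `|f t n| <= M n by near: t.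
have h1 := series_tail_le _ _ _ N ft cM.
have h2 := series_tail_le _ _ _ N lM cM.
have h3 : `|series l N - series (f t) N| <= e / 2 by near: t.
have -> : limn (series l) - limn (series (f t)) =
  (limn (series l) - series l N) + (series l N - series (f t) N)
   - (limn (series (f t)) - series (f t) N) by ring.
apply: le_trans (ler_normB _ _) _.
have := ler_normD (limn (series l) - series l N) (series l N - series (f t) N).
lra.
Unshelve. all: by end_near. Qed.

Lemma is_derive_within_is_derive (R : realType) (D : set R) (f : R -> R) (x l : R) :
  is_derive x 1 f l -> is_derive_within D f x l.
Proof.
move=> [fx fl]; apply: cvg_within_filter; move: fx; rewrite /derivable => fx.
have {fl fx} : h^-1 *: ((f \o shift x) (h *: 1) - f x) @[h --> 0^'] --> l.
  by rewrite -fl.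
move=> /cvgrPdist_le H; apply/cvgrPdist_le => e e0.
have /nbhs_ballP[r /= r0 rH] := H e e0.
apply/nbhs_ballP; exists r => //= y xy yx.
(* The increment [h] of the two-sided derivative becomes [y - x]. *)
have := rH (y - x); rewrite /= /ball/= sub0r normrN distrC.
rewrite subr_eq0 => /(_ xy yx).
by rewrite /= /GRing.scale/= mulr1 subrK [X in `|_ - X|]mulrC.
Qed.

Lemma cos_lipschitz (R : realType) (x y : R) : `|cos x - cos y| <= `|x - y|.
Proof.
wlog xy : x y / y <= x => [H|].
  by have [/H//|/ltW/H] := leP y x; rewrite distrC [X in _ <= X]distrC.
have [z _ ->] : exists2 c, c \in `[y, x] & cos x - cos y = - sin c * (x - y).
  apply: MVT_segment => //; apply: continuous_subspaceT; exact: continuous_cos.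
by rewrite normrM normrN ler_piMl// sin_max.
Qed.

(** One phase common to all terms suffices, since differentiation shifts every phase by the same
    [pi / 2]. *)
Definition trig_series (R : realType) (c w : R ^nat) (phi t : R) : R :=
  limn (series (fun p => c p * cos (w p * t + phi))).

Lemma norm_trig_term_le (R : realType) (c x : R) : `|c * cos x| <= `|c|.
Proof. by rewrite normrM ler_piMr// cos_max. Qed.

Lemma continuous_trig_series (R : realType) (c w : R ^nat) (phi : R) :
  cvgn (series (fun p => `|c p|)) -> continuous (trig_series R c w phi).
Proof.
move=> cc x; apply: (tannery _ _ _ _ _ _ _ cc) => [|n|n].
- by near=> t => n; exact: norm_trig_term_le.
- exact: norm_trig_term_le.
- apply: cvgM; first exact: cvg_cst.
  apply: continuous_cvg; first exact: continuous_cos.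
  by apply: cvgD; [apply: cvgM; [exact: cvg_cst|]|exact: cvg_cst].
Unshelve. all: by end_near. Qed.

Lemma is_derive_trig_term (R : realType) (c w phi x : R) :
  is_derive x 1 (fun t => c * cos (w * t + phi))
    (c * w * cos (w * x + (phi + pi / 2))).
Proof.
rewrite addrA cosDpihalf.
have dg : is_derive x 1 (fun t => w * t + phi) w.
  apply: is_derive_eq; by rewrite addr0 scaler1 ?addr0 /GRing.scale/= ?mulr1.
have dcos := @is_derive1_comp _ cos (fun t => w * t + phi) _ _ _
  (is_derive_cos (w * x + phi)) dg.
have -> : c * w * - sin (w * x + phi) = c *: (- sin (w * x + phi) * w).
  by rewrite /GRing.scale/=; ring.
exact: (is_deriveZ _ dcos).
Qed.

(** The first summability hypothesis lets the difference quotient be written as a series of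
    quotients; the second one dominates that series. *)
Lemma is_derive_within_trig_series (R : realType) (D : set R) (c w : R ^nat)
    (phi x : R) :
  cvgn (series (fun p => `|c p|)) -> cvgn (series (fun p => `|c p * w p|)) ->
  is_derive_within D (trig_series R c w phi) x
    (trig_series R (fun p => c p * w p) w (phi + pi / 2) x).
Proof.
move=> cc cw.
have ct t : cvgn (series (fun p => c p * cos (w p * t + phi))).
  apply: normed_cvg; apply: series_le_cvg cc => // n; first exact: normr_ge0.
  exact: norm_trig_term_le.
set f := fun t p => c p * cos (w p * t + phi).
have quotE :
    (fun y => (trig_series R c w phi y - trig_series R c w phi x) / (y - x)) =
    (fun y => limn (series ((y - x)^-1 *: (f y - f x)))).
  apply/funext => y; rewrite lim_seriesZ; last by apply: is_cvg_seriesB; exact: ct.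
  rewrite lim_seriesB; [|exact: ct|exact: ct].
  by rewrite mulrC.
rewrite /is_derive_within quotE.
apply: (tannery _ _ _ _ _ _ _ cw) => [|n|n].
- near=> y => n.
  have yx : 0 < `|y - x| by rewrite normr_gt0 subr_eq0; near: y;
    exact: cvg_within (nbhs_dnbhs_neq _).
  rewrite /= /GRing.scale/= -mulrBr normrM mulrC normfV ler_pdivrMr//.
  (* In the difference of the two arguments of [cos] the phase cancels, leaving [w n * (y - x)]. *)
  rewrite !normrM -mulrA ler_wpM2l// (le_trans (cos_lipschitz _ _ _))//.
  by rewrite -normrM mulrBr opprD addrACA subrr addr0.
- exact: norm_trig_term_le.
- have /(is_derive_within_is_derive _ D) := is_derive_trig_term R (c n) (w n) phi x.
  rewrite /is_derive_within; under eq_fun => y do rewrite mulrC.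
  exact.
Unshelve. all: by end_near. Qed.

(** Induction on [m] with [c] and [phi] general: summability of order [k] for the coefficients
    [c p * w p] is that of order [k.+1] for [c]. *)
Lemma class_C_trig_series (R : realType) (D : set R) (m : nat) (c w : R ^nat)
    (phi : R) :
  (forall k, (k <= m)%N -> cvgn (series (fun p => `|c p * w p ^+ k|))) ->
  class_C m D (trig_series R c w phi).
Proof.
elim: m c phi => [|m IH] c phi cw.
  apply: continuous_subspaceT; apply: continuous_trig_series.
  by have := cw 0 isT; under eq_fun do rewrite mulr1.
exists (trig_series R (fun p => c p * w p) w (phi + pi / 2)); split.
  move=> x _; apply: is_derive_within_trig_series.
    by have := cw 0 isT; under eq_fun do rewrite mulr1.
  exact: cw 1 isT.
apply: IH => k km; under eq_fun do rewrite -mulrA -exprS.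
exact: cw.
Qed.

Lemma is_cvg_series_prime_coef (R : realType) (alpha beta : R) (k : nat) :
  1 < alpha - k%:R * beta ->
  cvgn (series (fun p => `|(if prime p then p%:R `^ (- alpha) else 0) *
                           (2 * pi * p%:R `^ beta) ^+ k|)).
Proof.
move=> hk; have := is_cvg_series_powRN _ _ hk.
move=> /(@is_cvg_seriesZ _ _ ((2 * pi) ^+ k)).
apply: series_le_cvg => n /=; first exact: normr_ge0.
  by rewrite mulr_ge0 ?exprn_ge0 ?mulr_ge0 ?pi_ge0 ?powR_ge0.
have pi2 : 0 <= 2 * pi :> R by rewrite mulr_ge0 ?pi_ge0.
(* A prime is positive, which licenses adding exponents through [powRD]; at other indices the
   coefficient is 0. *)
case: ifPn => [/prime_gt0 n0|_]; last first.
  by rewrite mul0r normr0 mulr_ge0 ?exprn_ge0 ?powR_ge0.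
rewrite ger0_norm; last by rewrite mulr_ge0 ?exprn_ge0 ?(mulr_ge0 pi2) ?powR_ge0.
rewrite exprMn -(powR_mulrn k (powR_ge0 n%:R beta)) -powRrM mulrCA -powRD;
  last first.
  by rewrite pnatr_eq0 -lt0n n0 implybT.
by rewrite opprB addrC [beta * _]mulrC.
Qed.

(** Weierstrass M-test: the tail bound does not involve [t]. The shift [n.+1] matches [Vpartial],
    whose sum includes [p = n]. *)
Lemma uniform_cvg_series (R : realType) (A : set R) (f : R -> R ^nat) (M : R ^nat) :
  cvgn (series M) -> (forall t n, `|f t n| <= M n) ->
  {uniform A, (fun n t => series (f t) n.+1) @ \oo -->
     (fun t => limn (series (f t)))}.
Proof.
move=> cM fM P /uniform_nbhs[E [entE EP]].
have [e /= e0 eE] : exists2 e : R, 0 < e & forall x y, `|x - y| < e -> E (x, y).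
  move: entE; rewrite -entourage_ballE => -[e /= e0 eE].
  by exists e => // x y xy; apply: eE.
have /cvgrPdist_lt/(_ _ e0)[N _ tailN] := cM.
exists N => // n /= Nn; apply: EP => t _; apply: eE.
apply: le_lt_trans (series_tail_le _ _ _ n.+1 (fM t) cM) _.
exact: le_lt_trans (ler_norm _) (tailN _ (leqW Nn)).
Qed.

Theorem theorem3 (R : realType) (alpha beta : R)
    (halpha : 1 < alpha) (hbeta : 0 < beta) :
  [/\ forall t : R, t \in `[0, 1[ ->
        (\sum_(0 <= p <oo | prime p) `|Vterm alpha beta p t|%:E < +oo)%E,
      {uniform `[0, 1[, Vpartial alpha beta @ \oo --> Vlim alpha beta}
    & {within `[0, 1[, continuous (Vlim alpha beta)}] /\
  (forall m : nat, (1 <= m)%N -> 1 < alpha - m%:R * beta ->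
     class_C m `[0, 1[ (Vlim alpha beta)).
Proof.
(* Zero coefficients off the primes turn the filtered sums into plain series over all indices, with
   phase 0. *)
pose c p : R := if prime p then p%:R `^ (- alpha) else 0.
pose w p : R := 2 * pi * p%:R `^ beta.
have termE t p : (if prime p then Vterm alpha beta p t else 0) =
    c p * cos (w p * t + 0).
  by rewrite /Vterm /c addr0; case: ifP => // _; rewrite mul0r.
have partialE t n : \sum_(0 <= p < n | prime p) Vterm alpha beta p t =
    series (fun p => c p * cos (w p * t + 0)) n.
  by rewrite big_mkcond; apply: eq_bigr => p _; exact: termE.
have VlimE : Vlim alpha beta = trig_series R c w 0.
  apply/funext => t; rewrite /Vlim /trig_series.
  by congr (limn _); apply/funext => n; exact: partialE.
have VpartialE : Vpartial alpha beta =
    fun n t => series (fun p => c p * cos (w p * t + 0)) n.+1.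
  by apply/funext => n; apply/funext => t; exact: partialE.
have cvg_coef k : 1 < alpha - k%:R * beta ->
    cvgn (series (fun p => `|c p * w p ^+ k|)).
  exact: is_cvg_series_prime_coef.
have cvg_c : cvgn (series (fun p => `|c p|)).
  have := cvg_coef 0; rewrite mul0r subr0 => /(_ halpha).
  by under eq_fun do rewrite mulr1.
split; [split=> [t _||]|move=> m _ hm].
(* The extended-real partial sums are images of convergent real ones, so their limit is finite. *)
- have -> : (fun n => \sum_(0 <= p < n | prime p) `|Vterm alpha beta p t|%:E)%E =
      EFin \o series (fun p => `|c p * cos (w p * t + 0)|).
    apply/funext => n /=; rewrite -sumEFin big_mkcond; apply: eq_bigr => p _.
    by rewrite -termE; case: ifP => // _; rewrite normr0.
  rewrite EFin_lim ?ltry//; apply: series_le_cvg cvg_c => // n.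
  exact: norm_trig_term_le.
- rewrite VlimE VpartialE; apply: uniform_cvg_series cvg_c _ => t n.
  exact: norm_trig_term_le.
- rewrite VlimE; apply: continuous_subspaceT; exact: continuous_trig_series.
- rewrite VlimE; apply: class_C_trig_series => k km; apply: cvg_coef.
  (* As [beta] is positive, the hypothesis at [m] implies the one at every [k <= m]. *)
  by apply: lt_le_trans hm _; rewrite lerD2l lerN2 ler_wpM2r ?ler_nat// ltW.
Qed.
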